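(* Let $\mathcal{C}$ be a restriction category and $T$ a symmetric monoidal monad on $\mathcal{C}$. Then $T$ is mass preserving if and only if the Kleisli category $\mathcal{C}_T$ is a mass category.
   Context: Composition is diagrammatic ($f;g$ means first $f$, then $g$); the right unitor is $\rho_X:X\to X\otimes I$. A gs-monoidal category is a symmetric monoidal category with, for each object $X$, a discharger $!_X:X\to I$ and duplicator $\nabla_X:X\to X\otimes X$, compatible with the monoidal structure, with $\nabla_X$ coassociative, cocommutative, and $(X,\nabla_X,!_X)$ a comonoid. A restriction category is a gs-monoidal category in which every arrow $f:X\to Y$ satisfies $f;\nabla_Y=\nabla_X;(f\otimes f)$. A symmetric monoidal monad $(T,\eta,\mu)$ is a monad whose functor is lax symmetric monoidal with structure $c_{X,Y}:TX\otimes TY\to T(X\otimes Y)$ and $\eta_I:I\to TI$, such that $\eta,\mu$ are monoidal natural transformations. The Kleisli category $\mathcal{C}_T$ has arrows $X\to Y$ the arrows $X\to TY$, composition $f;^\sharp g=f;T(g);\mu$, tensor $f\otimes^\sharp g=(f\otimes g);c$, structural arrows $\nabla_X;\eta_{X\otimes X}$ and $!_X;\eta_I$. For $f:X\to Y$ in a gs-monoidal category, $\mathrm{mass}(f):=f;!_Y$ and $\mathrm{dom}(f):=\nabla_X;(\mathrm{id}_X\otimes(f;!_Y));\rho^{-1}_X$; a mass category is one with $\mathrm{dom}(f);\mathrm{mass}(f)=\mathrm{mass}(f)$ for all $f$. $T$ is mass preserving if for all $X$: $\nabla_{TX};c_{X,X};T(!_X\otimes !_X)=T(!_X);T(\rho_I)$.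 *)

(* Defs.v *)
From mathcomp Require Import ssreflect ssrfun.

Set Implicit Arguments.
Unset Strict Implicit.
Unset Printing Implicit Defensive.

Declare Scope cat_scope.
Delimit Scope cat_scope with cat.
Local Open Scope cat_scope.

Reserved Notation "X ~> Y" (at level 90, Y at level 89, no associativity).
Reserved Notation "f ;; g" (at level 55, left associativity).
Reserved Notation "X ⊗ Y" (at level 45, right associativity).

(** * Categories; composition is diagrammatic: [f ;; g] is first [f], then [g] *)

Record category := Category {
  ob :> Type;
  hom : ob -> ob -> Type;
  idm : forall X, hom X X;
  comp : forall X Y Z, hom X Y -> hom Y Z -> hom X Z;
  comp_idl : forall X Y (f : hom X Y), comp (idm X) f = f;
  comp_idr : forall X Y (f : hom X Y), comp f (idm Y) = f;
  comp_assoc : forall X Y Z W (f : hom X Y) (g : hom Y Z) (h : hom Z W),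
    comp (comp f g) h = comp f (comp g h)
}.
Arguments hom {c} X Y.
Arguments idm {c} X.
Arguments comp {c X Y Z} f g.

Notation "X ~> Y" := (hom X Y) : cat_scope.
Notation "f ;; g" := (comp f g) : cat_scope.

Record functor (C D : category) := Functor {
  fobj :> C -> D;
  fmap : forall X Y, X ~> Y -> fobj X ~> fobj Y;
  fmap_id : forall X, fmap (idm X) = idm (fobj X);
  fmap_comp : forall X Y Z (f : X ~> Y) (g : Y ~> Z),
    fmap (f ;; g) = fmap f ;; fmap g
}.
Arguments fmap {C D} F {X Y} f : rename.

Definition id_functor (C : category) : functor C C :=
  @Functor C C id (fun _ _ f => f) (fun _ => erefl) (fun _ _ _ _ _ => erefl).

Lemma comp_functor_id (C D E : category) (F : functor C D) (G : functor D E) X :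
  fmap G (fmap F (idm X)) = idm (G (F X)).
Proof. by rewrite !fmap_id. Qed.

Lemma comp_functor_comp (C D E : category) (F : functor C D) (G : functor D E)
    X Y Z (f : X ~> Y) (g : Y ~> Z) :
  fmap G (fmap F (f ;; g)) = fmap G (fmap F f) ;; fmap G (fmap F g).
Proof. by rewrite !fmap_comp. Qed.

(* first F, then G *)
Definition comp_functor (C D E : category) (F : functor C D) (G : functor D E) :
    functor C E :=
  @Functor C E (fun X => G (F X)) (fun _ _ f => fmap G (fmap F f))
    (comp_functor_id F G) (comp_functor_comp F G).

Definition is_natural (C D : category) (F G : functor C D)
    (t : forall X, F X ~> G X) : Prop :=
  forall X Y (f : X ~> Y), fmap F f ;; t Y = t X ;; fmap G f.

(** * Symmetric monoidal categories *)

(* The unitors point away from the unit: X ~> I ⊗ X and X ~> X ⊗ I. *)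
Record smcat := SMCat {
  smcat_category :> category;
  tensor : smcat_category -> smcat_category -> smcat_category;
  unit_ob : smcat_category;
  tensorm : forall X Y X' Y' : smcat_category,
    X ~> Y -> X' ~> Y' -> tensor X X' ~> tensor Y Y';
  associator : forall X Y Z : smcat_category,
    tensor (tensor X Y) Z ~> tensor X (tensor Y Z);
  associator_inv : forall X Y Z : smcat_category,
    tensor X (tensor Y Z) ~> tensor (tensor X Y) Z;
  lunitor : forall X : smcat_category, X ~> tensor unit_ob X;
  lunitor_inv : forall X : smcat_category, tensor unit_ob X ~> X;
  runitor : forall X : smcat_category, X ~> tensor X unit_ob;
  runitor_inv : forall X : smcat_category, tensor X unit_ob ~> X;
  braiding : forall X Y : smcat_category, tensor X Y ~> tensor Y X;
  tensorm_id : forall X Y : smcat_category,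
    tensorm (idm X) (idm Y) = idm (tensor X Y);
  tensorm_comp : forall (X Y Z X' Y' Z' : smcat_category)
      (f : X ~> Y) (g : Y ~> Z) (f' : X' ~> Y') (g' : Y' ~> Z'),
    tensorm (f ;; g) (f' ;; g') = tensorm f f' ;; tensorm g g';
  associatorK : forall X Y Z : smcat_category,
    associator X Y Z ;; associator_inv X Y Z = idm (tensor (tensor X Y) Z);
  associatorVK : forall X Y Z : smcat_category,
    associator_inv X Y Z ;; associator X Y Z = idm (tensor X (tensor Y Z));
  lunitorK : forall X : smcat_category, lunitor X ;; lunitor_inv X = idm X;
  lunitorVK : forall X : smcat_category,
    lunitor_inv X ;; lunitor X = idm (tensor unit_ob X);
  runitorK : forall X : smcat_category, runitor X ;; runitor_inv X = idm X;
  runitorVK : forall X : smcat_category,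
    runitor_inv X ;; runitor X = idm (tensor X unit_ob);
  braidingK : forall X Y : smcat_category,
    braiding X Y ;; braiding Y X = idm (tensor X Y);
  associator_nat : forall (X Y Z X' Y' Z' : smcat_category)
      (f : X ~> X') (g : Y ~> Y') (h : Z ~> Z'),
    tensorm (tensorm f g) h ;; associator X' Y' Z' =
    associator X Y Z ;; tensorm f (tensorm g h);
  lunitor_nat : forall (X Y : smcat_category) (f : X ~> Y),
    f ;; lunitor Y = lunitor X ;; tensorm (idm unit_ob) f;
  runitor_nat : forall (X Y : smcat_category) (f : X ~> Y),
    f ;; runitor Y = runitor X ;; tensorm f (idm unit_ob);
  braiding_nat : forall (X Y X' Y' : smcat_category)
      (f : X ~> Y) (f' : X' ~> Y'),
    tensorm f f' ;; braiding Y Y' = braiding X X' ;; tensorm f' f;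
  pentagon : forall X Y Z W : smcat_category,
    associator (tensor X Y) Z W ;; associator X Y (tensor Z W) =
    tensorm (associator X Y Z) (idm W) ;; associator X (tensor Y Z) W ;;
      tensorm (idm X) (associator Y Z W);
  triangle : forall X Y : smcat_category,
    tensorm (runitor X) (idm Y) ;; associator X unit_ob Y =
    tensorm (idm X) (lunitor Y);
  hexagon : forall X Y Z : smcat_category,
    associator X Y Z ;; braiding X (tensor Y Z) ;; associator Y Z X =
    tensorm (braiding X Y) (idm Z) ;; associator Y X Z ;;
      tensorm (idm Y) (braiding X Z)
}.
Arguments tensor {s} X Y.
Arguments unit_ob {s}.
Arguments tensorm {s X Y X' Y'} f g.
Arguments associator {s} X Y Z.
Arguments associator_inv {s} X Y Z.
Arguments lunitor {s} X.
Arguments lunitor_inv {s} X.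
Arguments runitor {s} X.
Arguments runitor_inv {s} X.
Arguments braiding {s} X Y.

Notation "X ⊗ Y" := (tensor X Y) : cat_scope.
Notation "f ⊗m g" := (tensorm f g) (at level 45, right associativity) : cat_scope.
Notation "'II'" := unit_ob : cat_scope.

Definition middle_swap (C : smcat) (X Y Z W : C) :
    (X ⊗ Y) ⊗ (Z ⊗ W) ~> (X ⊗ Z) ⊗ (Y ⊗ W) :=
  associator X Y (Z ⊗ W) ;;
  (idm X ⊗m (associator_inv Y Z W ;; (braiding Y Z ⊗m idm W) ;; associator Z Y W)) ;;
  associator_inv X Z (Y ⊗ W).

(** * gs-monoidal categories *)

Record gscat := GSCat {
  gscat_smcat :> smcat;
  discharge : forall X : gscat_smcat, X ~> II;
  duplicate : forall X : gscat_smcat, X ~> X ⊗ X;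
  duplicate_assoc : forall X : gscat_smcat,
    duplicate X ;; (duplicate X ⊗m idm X) ;; associator X X X =
    duplicate X ;; (idm X ⊗m duplicate X);
  duplicate_comm : forall X : gscat_smcat,
    duplicate X ;; braiding X X = duplicate X;
  duplicate_dischargel : forall X : gscat_smcat,
    duplicate X ;; (discharge X ⊗m idm X) = lunitor X;
  duplicate_discharger : forall X : gscat_smcat,
    duplicate X ;; (idm X ⊗m discharge X) = runitor X;
  discharge_unit : discharge II = idm II;
  duplicate_unit : duplicate II = runitor II;
  discharge_tensor : forall X Y : gscat_smcat,
    discharge (X ⊗ Y) = (discharge X ⊗m discharge Y) ;; runitor_inv II;
  duplicate_tensor : forall X Y : gscat_smcat,
    duplicate (X ⊗ Y) = (duplicate X ⊗m duplicate Y) ;; middle_swap X X Y Y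
}.
Arguments discharge {g} X.
Arguments duplicate {g} X.

(* Every arrow commutes with the duplicators; this is stronger than the notion
   of restriction category of Cockett and Lack. *)
Definition restriction_category (C : gscat) : Prop :=
  forall (X Y : C) (f : X ~> Y), f ;; duplicate Y = duplicate X ;; (f ⊗m f).

Definition mass (C : gscat) (X Y : C) (f : X ~> Y) : X ~> II :=
  f ;; discharge Y.

Definition dom (C : gscat) (X Y : C) (f : X ~> Y) : X ~> X :=
  duplicate X ;; (idm X ⊗m (f ;; discharge Y)) ;; runitor_inv X.

Definition mass_category (C : gscat) : Prop :=
  forall (X Y : C) (f : X ~> Y), dom f ;; mass f = mass f.

(** * Symmetric monoidal monads *)

Record is_lax_symmetric_monoidal (C D : smcat) (F : functor C D)
    (phi : forall X Y : C, F X ⊗ F Y ~> F (X ⊗ Y)) (phi0 : II ~> F II) : Prop :=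
  IsLaxSymmetricMonoidal {
  lax_nat : forall (X Y X' Y' : C) (f : X ~> Y) (f' : X' ~> Y'),
    (fmap F f ⊗m fmap F f') ;; phi Y Y' = phi X X' ;; fmap F (f ⊗m f');
  lax_assoc : forall X Y Z : C,
    (phi X Y ⊗m idm (F Z)) ;; phi (X ⊗ Y) Z ;; fmap F (associator X Y Z) =
    associator (F X) (F Y) (F Z) ;; (idm (F X) ⊗m phi Y Z) ;; phi X (Y ⊗ Z);
  lax_lunit : forall X : C,
    lunitor (F X) ;; (phi0 ⊗m idm (F X)) ;; phi II X = fmap F (lunitor X);
  lax_runit : forall X : C,
    runitor (F X) ;; (idm (F X) ⊗m phi0) ;; phi X II = fmap F (runitor X);
  lax_braiding : forall X Y : C,
    phi X Y ;; fmap F (braiding X Y) = braiding (F X) (F Y) ;; phi Y X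
}.

Record is_monoidal_natural (C D : smcat) (F G : functor C D)
    (phi : forall X Y : C, F X ⊗ F Y ~> F (X ⊗ Y)) (phi0 : II ~> F II)
    (psi : forall X Y : C, G X ⊗ G Y ~> G (X ⊗ Y)) (psi0 : II ~> G II)
    (t : forall X, F X ~> G X) : Prop :=
  IsMonoidalNatural {
  monoidal_natural : is_natural t;
  monoidal_tensor : forall X Y : C,
    phi X Y ;; t (X ⊗ Y) = (t X ⊗m t Y) ;; psi X Y;
  monoidal_unit : phi0 ;; t II = psi0
}.

Record monad (C : category) := Monad {
  monad_functor :> functor C C;
  eta : forall X : C, X ~> monad_functor X;
  mu : forall X : C, monad_functor (monad_functor X) ~> monad_functor X;
  eta_nat : is_natural (F := id_functor C) (G := monad_functor) eta;
  mu_nat : is_natural (F := comp_functor monad_functor monad_functor)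
                      (G := monad_functor) mu;
  mu_etal : forall X : C, eta (monad_functor X) ;; mu X = idm (monad_functor X);
  mu_etar : forall X : C, fmap monad_functor (eta X) ;; mu X = idm (monad_functor X);
  mu_assoc : forall X : C, fmap monad_functor (mu X) ;; mu X = mu (monad_functor X) ;; mu X
}.
Arguments eta {C} T X : rename.
Arguments mu {C} T X : rename.

Record symmetric_monoidal_monad (C : smcat) := SymmetricMonoidalMonad {
  smm_monad :> monad C;
  lax_tensor : forall X Y : C,
    smm_monad X ⊗ smm_monad Y ~> smm_monad (X ⊗ Y);
  smm_lax : is_lax_symmetric_monoidal lax_tensor (eta smm_monad II);
  smm_eta : is_monoidal_natural (F := id_functor C) (G := smm_monad)
    (fun X Y : C => idm (X ⊗ Y)) (idm II) lax_tensor (eta smm_monad II)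
    (eta smm_monad);
  smm_mu : is_monoidal_natural
    (F := comp_functor smm_monad smm_monad) (G := smm_monad)
    (fun X Y : C => lax_tensor (smm_monad X) (smm_monad Y) ;;
                    fmap smm_monad (lax_tensor X Y))
    (eta smm_monad II ;; fmap smm_monad (eta smm_monad II))
    lax_tensor (eta smm_monad II) (mu smm_monad)
}.
Arguments lax_tensor {C} T X Y : rename.

Definition mass_preserving (C : gscat) (T : symmetric_monoidal_monad C) : Prop :=
  forall X : C,
    duplicate (T X) ;; lax_tensor T X X ;; fmap T (discharge X ⊗m discharge X) =
    fmap T (discharge X) ;; fmap T (runitor II).

(** * The Kleisli category *)

Section KleisliCategory.
Variables (C : category) (T : monad C).

Definition kleisli_comp (X Y Z : C) (f : X ~> T Y) (g : Y ~> T Z) : X ~> T Z :=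
  f ;; fmap T g ;; mu T Z.

(* The embedding of C into the Kleisli category. *)
Definition kleisli_pure (X Y : C) (f : X ~> Y) : X ~> T Y := f ;; eta T Y.

Lemma kleisli_idl (X Y : C) (f : X ~> T Y) : kleisli_comp (eta T X) f = f.
Proof.
by rewrite /kleisli_comp -(eta_nat T f) /= comp_assoc mu_etal comp_idr.
Qed.

Lemma kleisli_idr (X Y : C) (f : X ~> T Y) : kleisli_comp f (eta T Y) = f.
Proof. by rewrite /kleisli_comp comp_assoc mu_etar comp_idr. Qed.

Lemma kleisli_assoc (X Y Z W : C) (f : X ~> T Y) (g : Y ~> T Z) (h : Z ~> T W) :
  kleisli_comp (kleisli_comp f g) h = kleisli_comp f (kleisli_comp g h).
Proof.
rewrite /kleisli_comp !fmap_comp !comp_assoc mu_assoc.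
by rewrite -(comp_assoc (mu T Z)) -(mu_nat T h) /= !comp_assoc.
Qed.

Definition kleisli_category : category :=
  Category (hom := fun X Y : C => X ~> T Y) kleisli_idl kleisli_idr kleisli_assoc.

Lemma kleisli_pure_id (X : C) : eta T X = kleisli_pure (idm X).
Proof. by rewrite /kleisli_pure comp_idl. Qed.

Lemma kleisli_comp_purel (X Y Z : C) (f : X ~> Y) (g : Y ~> T Z) :
  kleisli_comp (kleisli_pure f) g = f ;; g.
Proof.
by have := kleisli_idl g; rewrite /kleisli_comp /kleisli_pure !comp_assoc => ->.
Qed.

Lemma kleisli_comp_purer (X Y Z : C) (f : X ~> T Y) (g : Y ~> Z) :
  kleisli_comp f (kleisli_pure g) = f ;; fmap T g.
Proof.
by rewrite /kleisli_comp /kleisli_pure fmap_comp !comp_assoc mu_etar comp_idr.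
Qed.

Lemma kleisli_comp_pure (X Y Z : C) (f : X ~> Y) (g : Y ~> Z) :
  kleisli_comp (kleisli_pure f) (kleisli_pure g) = kleisli_pure (f ;; g).
Proof. by rewrite kleisli_comp_purel /kleisli_pure comp_assoc. Qed.

End KleisliCategory.
Arguments kleisli_comp {C} T {X Y Z} f g.
Arguments kleisli_pure {C} T {X Y} f.

Section KleisliMonoidal.
Variables (C : smcat) (T : symmetric_monoidal_monad C).

Local Notation pure := (kleisli_pure T).
Local Notation kcomp := (kleisli_comp T).

Definition kleisli_tensor (X Y X' Y' : C) (f : X ~> T Y) (g : X' ~> T Y') :
    X ⊗ X' ~> T (Y ⊗ Y') :=
  (f ⊗m g) ;; lax_tensor T Y Y'.

Lemma eta_tensor (X Y : C) :
  (eta T X ⊗m eta T Y) ;; lax_tensor T X Y = eta T (X ⊗ Y).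
Proof. by rewrite -(monoidal_tensor (smm_eta T)) comp_idl. Qed.

Lemma kleisli_tensor_pure (X Y X' Y' : C) (f : X ~> Y) (g : X' ~> Y') :
  kleisli_tensor (pure f) (pure g) = pure (f ⊗m g).
Proof.
by rewrite /kleisli_tensor /kleisli_pure tensorm_comp comp_assoc eta_tensor.
Qed.

Lemma kleisli_tensor_id (X Y : C) :
  kleisli_tensor (eta T X) (eta T Y) = eta T (X ⊗ Y).
Proof. exact: eta_tensor. Qed.

Lemma kleisli_tensor_comp (X Y Z X' Y' Z' : C)
    (f : X ~> T Y) (g : Y ~> T Z) (f' : X' ~> T Y') (g' : Y' ~> T Z') :
  kleisli_tensor (kcomp f g) (kcomp f' g') =
  kcomp (kleisli_tensor f f') (kleisli_tensor g g').
Proof.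
rewrite /kleisli_tensor /kleisli_comp !tensorm_comp !comp_assoc.
rewrite -(monoidal_tensor (smm_mu T)) fmap_comp.
rewrite -!comp_assoc; congr (_ ;; _ ;; _).
by rewrite !comp_assoc (lax_nat (smm_lax T)).
Qed.

Lemma kleisli_associator_nat (X Y Z X' Y' Z' : C)
    (f : X ~> T X') (g : Y ~> T Y') (h : Z ~> T Z') :
  kcomp (kleisli_tensor (kleisli_tensor f g) h) (pure (associator X' Y' Z')) =
  kcomp (pure (associator X Y Z)) (kleisli_tensor f (kleisli_tensor g h)).
Proof.
rewrite kleisli_comp_purer kleisli_comp_purel /kleisli_tensor.
rewrite -[h in LHS]comp_idr -[f in RHS]comp_idr !tensorm_comp.
rewrite !comp_assoc -(comp_assoc (lax_tensor T X' Y' ⊗m _)) (lax_assoc (smm_lax T)).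
by rewrite -!comp_assoc associator_nat.
Qed.

Lemma kleisli_lunitor_nat (X Y : C) (f : X ~> T Y) :
  kcomp f (pure (lunitor Y)) =
  kcomp (pure (lunitor X)) (kleisli_tensor (eta T II) f).
Proof.
rewrite kleisli_comp_purer kleisli_comp_purel /kleisli_tensor.
rewrite -(lax_lunit (smm_lax T)) -!comp_assoc lunitor_nat.
by congr (_ ;; _); rewrite !comp_assoc -tensorm_comp comp_idl comp_idr.
Qed.

Lemma kleisli_runitor_nat (X Y : C) (f : X ~> T Y) :
  kcomp f (pure (runitor Y)) =
  kcomp (pure (runitor X)) (kleisli_tensor f (eta T II)).
Proof.
rewrite kleisli_comp_purer kleisli_comp_purel /kleisli_tensor.
rewrite -(lax_runit (smm_lax T)) -!comp_assoc runitor_nat.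
by congr (_ ;; _); rewrite !comp_assoc -tensorm_comp comp_idl comp_idr.
Qed.

Lemma kleisli_braiding_nat (X Y X' Y' : C) (f : X ~> T Y) (f' : X' ~> T Y') :
  kcomp (kleisli_tensor f f') (pure (braiding Y Y')) =
  kcomp (pure (braiding X X')) (kleisli_tensor f' f).
Proof.
rewrite kleisli_comp_purer kleisli_comp_purel /kleisli_tensor.
by rewrite comp_assoc (lax_braiding (smm_lax T)) -!comp_assoc braiding_nat.
Qed.

Definition kleisli_smcat : smcat.
Proof.
refine (@SMCat (kleisli_category T)
  (fun X Y : C => X ⊗ Y) (II : C) kleisli_tensor
  (fun X Y Z => pure (associator X Y Z))
  (fun X Y Z => pure (associator_inv X Y Z))
  (fun X => pure (lunitor X)) (fun X => pure (lunitor_inv X))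
  (fun X => pure (runitor X)) (fun X => pure (runitor_inv X))
  (fun X Y => pure (braiding X Y))
  kleisli_tensor_id kleisli_tensor_comp _ _ _ _ _ _ _
  kleisli_associator_nat kleisli_lunitor_nat kleisli_runitor_nat
  kleisli_braiding_nat _ _ _) => /= *;
rewrite !kleisli_pure_id ?kleisli_tensor_pure ?kleisli_comp_pure;
rewrite ?kleisli_tensor_pure ?kleisli_comp_pure; congr (pure _).
- exact: associatorK.
- exact: associatorVK.
- exact: lunitorK.
- exact: lunitorVK.
- exact: runitorK.
- exact: runitorVK.
- exact: braidingK.
- exact: pentagon.
- exact: triangle.
- exact: hexagon.
Defined.

Lemma kleisli_middle_swap (X Y Z W : C) :
  @middle_swap kleisli_smcat X Y Z W = pure (middle_swap X Y Z W).
Proof.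
by rewrite /middle_swap /= !kleisli_pure_id
     !(kleisli_tensor_pure, kleisli_comp_pure).
Qed.

End KleisliMonoidal.

Section KleisliGS.
Variables (C : gscat) (T : symmetric_monoidal_monad C).

Local Notation pure := (kleisli_pure T).

Definition kleisli_gscat : gscat.
Proof.
refine (@GSCat (kleisli_smcat T)
  (fun X : C => pure (discharge X)) (fun X : C => pure (duplicate X))
  _ _ _ _ _ _ _ _) => *; rewrite ?kleisli_middle_swap /=;
rewrite ?kleisli_pure_id ?(kleisli_tensor_pure, kleisli_comp_pure);
congr (pure _).
- exact: duplicate_assoc.
- exact: duplicate_comm.
- exact: duplicate_dischargel.
- exact: duplicate_discharger.
- exact: discharge_unit.
- exact: duplicate_unit.
- exact: discharge_tensor.
- exact: duplicate_tensor.
Defined.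

End KleisliGS.

(* Main.v *)
From mathcomp Require Import ssreflect ssrfun.
Require Import Defs.

(** In any gs-monoidal category [dom f ;; mass f] consists of two copies of
    [mass f] run in parallel. In the Kleisli category, where the base arrows can
    be duplicated, this is [f] followed by the left-hand side of the mass
    preservation equation at the codomain, up to the unitor. So the mass equation
    for [f] is mass preservation precomposed with [f], and the identity of [T X],
    seen as a Kleisli arrow from [T X] to [X], gives the converse. *)

Local Open Scope cat_scope.

Lemma runitor_inv_nat (C : smcat) (X Y : C) (f : X ~> Y) :
  runitor_inv X ;; f = (f ⊗m idm II) ;; runitor_inv Y.
Proof.
rewrite -[f in LHS]comp_idr -(runitorK Y) -(comp_assoc f) runitor_nat.
by rewrite -!comp_assoc runitorVK comp_idl.
Qed.

(** Naturality of [runitor_inv] moves the trailing [mass f] into the left factor; interchange sets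
    it beside the copy inside [dom f]. *)
Lemma dom_mass (C : gscat) (X Y : C) (f : X ~> Y) :
  dom f ;; mass f = duplicate X ;; (mass f ⊗m mass f) ;; runitor_inv II.
Proof.
rewrite /dom comp_assoc runitor_inv_nat -/(mass f) -!comp_assoc.
by rewrite (comp_assoc (duplicate X)) -tensorm_comp comp_idl comp_idr.
Qed.

(** [hC] applies to [f] as a base arrow into [T Y], trading two parallel copies for one; naturality
    of [lax_tensor] gathers the dischargers under [T]. *)
Lemma kleisli_dom_mass (C : gscat) (hC : restriction_category C)
    (T : symmetric_monoidal_monad C) (X Y : C) (f : X ~> T Y) :
  @dom (kleisli_gscat T) X Y f ;; @mass (kleisli_gscat T) X Y f =
  f ;; (duplicate (T Y) ;; lax_tensor T Y Y ;;
        fmap T (discharge Y ⊗m discharge Y)) ;; fmap T (runitor_inv II) :> (X ~> T II).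
Proof.
rewrite dom_mass /mass /= !kleisli_comp_purer kleisli_comp_purel /kleisli_tensor.
rewrite tensorm_comp -!comp_assoc hC !comp_assoc -(comp_assoc (lax_tensor T Y Y)).
by rewrite -(lax_nat (smm_lax T)) !comp_assoc.
Qed.

Theorem theorem5p4 (C : gscat) (hC : restriction_category C)
    (T : symmetric_monoidal_monad C) :
  mass_preserving T <-> mass_category (kleisli_gscat T).
Proof.
split=> [hT X Y f | hM X].
  rewrite (kleisli_dom_mass _ hC T X Y) hT /mass /= kleisli_comp_purer.
  by rewrite !comp_assoc -fmap_comp runitorK fmap_id comp_idr.
have := hM (T X) X (idm (T X)).
rewrite (kleisli_dom_mass _ hC T (T X) X) /mass /= kleisli_comp_purer.
(* The mass equation is now a formula for [fmap T (discharge X)], substituted on the right. *)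
rewrite !comp_idl => <-.
by rewrite [RHS]comp_assoc -fmap_comp runitorVK fmap_id comp_idr.
Qed.
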